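(* Let $t\ge 2$ be an integer. If $G$ is a $3$-graph not containing $L_t^3$ as a subgraph, then $\lambda(G)\le \lambda(K_{2t}^{3})$. Furthermore, there is $c_2=c_2(t)>0$ such that if $G$ is a $3$-graph not containing $L_t^3$ as a subgraph, $G$ covers pairs, and $G\ne K_{2t}^3$, then $$\lambda(G)\le \lambda(K_{2t}^{3})-c_2=\frac{(2t-1)(t-1)}{12t^2}-c_2.$$
   Context: An $r$-graph is a vertex set with a family of $r$-element subsets (edges). $K^r_p$ is the complete $r$-graph on $p$ vertices. The linear star $L^r_t$ is the $r$-graph with $t$ edges that all contain a common vertex $x$ and are pairwise disjoint outside $\{x\}$. An $r$-graph covers pairs if every pair of its vertices is contained in some edge. For an $r$-graph $G$ on $[n]$ and $\vec x\in[0,\infty)^n$, $\lambda(G,\vec x)=\sum_{e\in E(G)}\prod_{i\in e}x_i$, and $\lambda(G)=\max\{\lambda(G,\vec x):\vec x\ge0,\ \sum_ix_i=1\}$. *)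

(* Defs.v *)
From HB Require Import structures.
From mathcomp Require Import all_boot all_order all_algebra.
From mathcomp Require Import all_classical all_reals.
From mathcomp Require Import topology normedtype derive.

Set Implicit Arguments.
Unset Strict Implicit.
Unset Printing Implicit Defensive.

Import Order.TTheory GRing.Theory Num.Theory.
Import numFieldTopology.Exports numFieldNormedType.Exports.

Local Open Scope ring_scope.

Record hypergraph := Hypergraph {
  vert : finType;
  edges : {set {set vert}} }.

(* [uniform r G] : G is an r-graph. *)
Definition uniform (r : nat) (G : hypergraph) : Prop :=
  forall e : {set vert G}, e \in edges G -> #|e| = r.

Definition complete (r p : nat) : hypergraph :=
  @Hypergraph 'I_p (finset (fun e : {set 'I_p} => #|e| == r)).

(* [None] is the centre of the star; [Some (i, j)], for j < r - 1, are the
   non-central vertices of its i-th edge. Meaningful for r >= 1. *)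
Definition star_edge (r t : nat) (i : 'I_t) :
    {set option ('I_t * 'I_r.-1)%type} :=
  (None |: finset (fun v => if v is Some (k, _) then k == i else false))%SET.

Definition linear_star (r t : nat) : hypergraph :=
  @Hypergraph (option ('I_t * 'I_r.-1)%type)
    (@star_edge r t @: [set: 'I_t])%SET.

(* [subgraph_of H G] : G contains a (not necessarily induced) copy of H. *)
Definition subgraph_of (H G : hypergraph) : Prop :=
  exists f : vert H -> vert G, injective f /\
    forall e : {set vert H}, e \in edges H -> (f @: e)%SET \in edges G.

Definition isomorphic (G H : hypergraph) : Prop :=
  exists f : vert G -> vert H, bijective f /\
    forall e : {set vert G}, ((f @: e)%SET \in edges H) = (e \in edges G).

Definition covers_pairs (G : hypergraph) : Prop :=
  forall u v : vert G, u != v ->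
    exists e : {set vert G}, [/\ e \in edges G, u \in e & v \in e].

Definition lagrange_poly (R : realType) (G : hypergraph) (x : vert G -> R) : R :=
  \sum_(e in edges G) \prod_(i in e) x i.

Definition simplex (R : realType) (V : finType) : set (V -> R) :=
  [set x | (forall i, 0 <= x i) /\ \sum_i x i = 1]%classic.

(* The supremum is a maximum as soon as G has a vertex: see
   [lagrangian_attained]. For the graph without vertices it is [sup set0 = 0]. *)
Definition lagrangian (R : realType) (G : hypergraph) : R :=
  sup (@lagrange_poly R G @` @simplex R (vert G))%classic.

Lemma complete_uniform (r p : nat) : uniform r (complete r p).
Proof. by move=> e; rewrite inE => /eqP. Qed.

Lemma card_star_edge (r t : nat) (i : 'I_t) :
  (0 < r)%N -> #|@star_edge r t i| = r.
Proof.
case: r => // r _; rewrite /star_edge cardsU1 inE /= add1n; congr _.+1.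
pose h (j : 'I_r) := Some (i, j) : option ('I_t * 'I_r)%type.
have inj_h : injective h by move=> j k [].
transitivity #|(h @: [set: 'I_r])%SET|; last first.
  by rewrite card_imset // cardsT card_ord.
apply: eq_card => -[[k j]|]; rewrite !inE.
  apply/eqP/imsetP => [->|[j' _ [-> _]] //]; by exists j; rewrite ?inE.
by apply/esym/negP => /imsetP[].
Qed.

Lemma linear_star_uniform (r t : nat) :
  (0 < r)%N -> uniform r (linear_star r t).
Proof. by move=> r0 e /imsetP[i _ ->]; exact: card_star_edge. Qed.

Lemma star_edgeI (r t : nat) (i j : 'I_t) : i != j ->
  (@star_edge r t i :&: @star_edge r t j)%SET = [set None]%SET.
Proof.
move=> ij; apply/setP => -[[k l]|]; rewrite !inE //=.
by apply/negP => /andP[/eqP-> /eqP e]; rewrite e eqxx in ij.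
Qed.

Lemma card_linear_star (r t : nat) :
  (1 < r)%N -> #|edges (linear_star r t)| = t.
Proof.
move=> r1; rewrite /= card_imset ?cardsT ?card_ord // => i j eij.
apply/eqP/negPn/negP => /(@star_edgeI r t).
rewrite eij finset.setIid => /(congr1 (fun A : {set _} => #|A|)).
by rewrite cards1 card_star_edge ?(ltnW r1) // => e; rewrite e in r1.
Qed.

Lemma coord_continuous (R : realType) (V : finType) (i : V) :
  continuous (fun x : {ptws V -> R} => x i : R).
Proof. exact: (@proj_continuous V (fun _ => R) i). Qed.

Lemma simplex_compact (R : realType) (V : finType) :
  compact (@simplex R V : set {ptws V -> R}).
Proof.
have cube := @tychonoff V (fun=> R) (fun=> `[0 : R, 1]%classic)
  (fun=> @segment_compact R 0 1).
have csum : continuous (fun x : {ptws V -> R} => \sum_i x i : R).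
  apply: continuous_big => [|i _]; [exact: add_continuous|].
  exact: coord_continuous.
have := compact_closedI cube (proj1 (continuous_closedP _) csum _ (@closed_eq R 1)).
congr compact; apply/seteqP; split => [x [xc x1]|x [x0 x1]] /=; split => // i.
  by have := xc i; rewrite /= in_itv /= => /andP[].
by rewrite /= in_itv /= x0 /= -x1 (bigD1 i) //= lerDl; exact: sumr_ge0.
Qed.

Lemma lagrange_poly_continuous (R : realType) (G : hypergraph) :
  continuous (@lagrange_poly R G : {ptws vert G -> R} -> R).
Proof.
apply: continuous_big => [|e _]; first exact: add_continuous.
apply: continuous_big => [|i _]; first exact: mul_continuous.
exact: coord_continuous.
Qed.

Lemma lagrangian_attained (R : realType) (G : hypergraph) (v : vert G) :
  exists x : vert G -> R, [/\ simplex x, @lagrange_poly R G x = lagrangian R G &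
    forall y : vert G -> R, simplex y -> @lagrange_poly R G y <= @lagrange_poly R G x].
Proof.
have s0 : (@simplex R (vert G) !=set0)%classic.
  exists (fun i => (i == v)%:R); split=> [i|]; first exact: ler0n.
  rewrite (bigD1 v) //= eqxx big1 ?addr0 // => i /negPf -> //.
have [x xS xmax] := @compact_EVT_max {ptws vert G -> R} R (@lagrange_poly R G) _ s0 (@simplex_compact R (vert G))
  (continuous_subspaceT (@lagrange_poly_continuous R G)).
have {}xS : simplex x := set_mem xS.
have ub (y : vert G -> R) : simplex y -> @lagrange_poly R G y <= @lagrange_poly R G x.
  by move=> yS; exact: (xmax y (mem_set yS)).
exists x; split=> //; apply/eqP; rewrite eq_le; apply/andP; split.
  apply: ub_le_sup; last by exists x.
  by exists (@lagrange_poly R G x) => _ [y yS <-]; exact: ub.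
apply: ge_sup; first by exists (@lagrange_poly R G x), x.
by move=> _ [y yS <-]; exact: ub.
Qed.

(* Main.v *)
(* Let x be an optimal weighting of an L_t-free 3-graph G, put z = 2t x and let i
   be a vertex of maximum weight a = z_i. Optimality at i gives
   24 t^2 lambda(G) <= Q, where Q is twice the Lagrange polynomial at z of the
   link of i, a graph without a matching of size t. Compressing the link towards
   heavy vertices keeps this property and does not decrease Q; a compressed graph
   without a t-matching is contained, for some s < t, in the graph in which the s
   heaviest vertices are joined to everything and the next 2t - 1 - 2s form a
   clique. As the other weights are at most a and sum to 2t - a, this yields
   Q <= (2t - 1)(2t - 2), with a loss of at least 1 when s > 0. When s = 0 and Q is
   nearly maximal, z is nearly 1 on a set W of 2t vertices and the rest is
   negligible: either W misses a triple, which costs a constant, or W is a clique,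
   which together with one edge leaving W would contain L_t, so that covering
   pairs forces G = K_2t. *)
Require Import Defs.
From mathcomp Require Import all_classical all_reals.
From mathcomp Require Import all_boot all_order all_algebra all_fingroup.
From mathcomp Require Import zify ring lra.

Set Implicit Arguments.
Unset Strict Implicit.
Unset Printing Implicit Defensive.

Import Order.TTheory GRing.Theory Num.Theory.

Local Open Scope set_scope.
Local Open Scope ring_scope.

Lemma simplex_max (R : realType) (T : finType) (x : T -> R) :
  simplex x -> exists2 i, 0 < x i & forall u, x u <= x i.
Proof.
case=> x0 x1; have [|v /= xv] := psumr_neq0P (P := predT) (fun u _ => x0 u).
  by rewrite x1; exact/eqP/oner_neq0.
have [i _ imax] := @arg_maxP _ R _ v predT x isT.
by exists i => [|u]; [exact: lt_le_trans xv (imax v isT)|exact: imax].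
Qed.

Section LagrangePolynomial.

Variables (R : realType) (G : hypergraph).
Implicit Types (x y : vert G -> R) (i : vert G).

Definition link_poly i x : R :=
  \sum_(e in edges G | i \in e) \prod_(j in e :\ i) x j.

Lemma lagrange_poly_ge0 x : (forall u, 0 <= x u) -> 0 <= lagrange_poly x.
Proof. by move=> x0; apply: sumr_ge0 => e _; exact: prodr_ge0. Qed.

(* An edge contains [i] at most once, so the Lagrange polynomial is affine in
   the weight of [i], with slope the polynomial of the link of [i]. *)
Lemma lagrange_poly_decr i (c : R) x :
  lagrange_poly (fun u => x u - c * (u == i)%:R) =
    lagrange_poly x - c * link_poly i x.
Proof.
have off (A : {set vert G}) : i \notin A ->
    \prod_(j in A) (x j - c * (j == i)%:R) = \prod_(j in A) x j.
  move=> iA; apply: eq_bigr => j jA.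
  by rewrite (negPf (memPn iA j jA)) mulr0 subr0.
rewrite /lagrange_poly (bigID (fun e : {set _} => i \in e)) /=.
rewrite [in RHS](bigID (fun e : {set _} => i \in e)) /= addrAC.
congr (_ + _); last by apply: eq_bigr => e /andP[_]; exact: off.
rewrite mulr_sumr -sumrB; apply: eq_bigr => e /andP[_ ie].
rewrite !(big_setD1 i ie) /= eqxx mulr1 off ?mulrBl //.
by rewrite !inE eqxx.
Qed.

Lemma lagrange_poly_scale (r : nat) (c : R) x : uniform r G ->
  lagrange_poly (fun u => c * x u) = c ^+ r * lagrange_poly x.
Proof.
move=> Gr; rewrite /lagrange_poly mulr_sumr; apply: eq_bigr => e /Gr eE.
by rewrite prodrMl eE.
Qed.

Lemma lagrange_poly_le_lagrangian x :
  simplex x -> lagrange_poly x <= lagrangian R G.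
Proof.
move=> xS; have [i _ _] := simplex_max xS.
by have [y [_ <- ->]] := lagrangian_attained R i.
Qed.

Lemma lagrangian_gt0_attained : 0 < lagrangian R G ->
  exists2 x : vert G -> R, simplex x & lagrange_poly x = lagrangian R G.
Proof.
have [[y /simplex_max[i _ _]] _|no_weight] :=
  pselect (exists y, @simplex R (vert G) y).
  by have [x [xS xE _]] := lagrangian_attained R i; exists x.
rewrite /lagrangian [X in sup X](_ : _ = classical_sets.set0) ?sup0 ?ltxx //.
by rewrite -classical_sets.subset0 => v [y yS _]; apply: no_weight; exists y.
Qed.

Lemma lagrange_poly_le_sum_expr (r : nat) x : uniform r G ->
  (forall u, 0 <= x u) -> 0 < \sum_u x u ->
  lagrange_poly x <= (\sum_u x u) ^+ r * lagrangian R G.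
Proof.
move=> Gr x0; set s := \sum_u x u => s0.
have sK : s * s^-1 = 1 by rewrite divff ?gt_eqF.
have -> : lagrange_poly x = s ^+ r * lagrange_poly (fun u => s^-1 * x u).
  by rewrite (lagrange_poly_scale _ _ Gr) mulrA -exprMn sK expr1n mul1r.
rewrite ler_wpM2l ?exprn_ge0 ?(ltW s0) //; apply: lagrange_poly_le_lagrangian.
split=> [u|]; first by rewrite mulr_ge0 // invr_ge0 ltW.
by rewrite -mulr_sumr mulrC.
Qed.

End LagrangePolynomial.

Lemma bernoulli_le (R : realDomainType) (c : R) (n : nat) :
  0 <= c <= 1 -> 1 - n%:R * c <= (1 - c) ^+ n.
Proof.
move=> /andP[c0 c1]; elim: n => [|n IHn]; first by rewrite mul0r subr0.
have le : (1 - c) * (1 - n%:R * c) <= (1 - c) ^+ n.+1.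
  by rewrite exprS ler_wpM2l // subr_ge0.
apply: le_trans le; rewrite -natr1; have := mulr_ge0 (ler0n R n) (sqr_ge0 c).
by lra.
Qed.

Lemma mulrn_le_of_geometric (R : realFieldType) (r : nat) (b L m : R) :
  0 <= L -> 0 < m ->
  (forall c, 0 < c -> c <= m -> c < 1 -> \sum_(j < r) (1 - c) ^+ j * L <= b) ->
  r%:R * L <= b.
Proof.
move=> L0 m0 geometric_le; apply/ler_addgt0Pr => d d0.
have rL0 : 0 < r%:R ^+ 2 * L + 1 by rewrite ltr_wpDl // mulr_ge0 // exprn_ge0.
pose c := Num.min m (Num.min (1 / 2) (d / (r%:R ^+ 2 * L + 1))).
have c0 : 0 < c by rewrite !lt_min m0 !divr_gt0.
have cm : c <= m by rewrite ge_min lexx.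
have c_half : c <= 1 / 2 by rewrite !ge_min lexx orbT.
have cd : c * (r%:R ^+ 2 * L + 1) <= d.
  by rewrite -ler_pdivlMr // !ge_min lexx !orbT.
have c1 : c < 1 by lra.
apply: (@le_trans _ _ (\sum_(j < r) (1 - r%:R * c) * L + d)).
  by rewrite sumr_const card_ord -[X in X + _]mulr_natl; lra.
rewrite lerD2r; apply: le_trans (geometric_le c c0 cm c1).
apply: ler_sum => j _; rewrite ler_wpM2r // (le_trans _ (bernoulli_le j _)) //.
  by rewrite lerD2l lerN2 ler_wpM2r ?(ltW c0) // ler_nat ltnW.
by rewrite !ltW.
Qed.

Section Optimum.

Variables (R : realType) (G : hypergraph) (r : nat).
Hypothesis Gr : uniform r G.

(* Removing a weight [c] from [i] and rescaling does not increase the value, so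
   [c * link_poly i x >= lambda (1 - (1 - c)^r)]; let [c] tend to [0]. *)
Lemma lagrangian_le_link_poly (x : vert G -> R) (i : vert G) :
  simplex x -> lagrange_poly x = lagrangian R G -> 0 < x i ->
  r%:R * lagrangian R G <= link_poly i x.
Proof.
move=> [x0 x1] xE xi; apply: (mulrn_le_of_geometric _ xi) => [|c c0 cxi c1].
  by rewrite -xE lagrange_poly_ge0.
have sumE : \sum_u (x u - c * (u == i)%:R) = 1 - c.
  rewrite sumrB x1 -mulr_sumr (bigD1 i) //= eqxx big1 ?addr0 ?mulr1 //.
  by move=> u /negPf->.
have := lagrange_poly_le_sum_expr (x := fun u => x u - c * (u == i)%:R) Gr.
rewrite sumE lagrange_poly_decr xE subr_gt0 => /(_ _ c1) decr_le.
rewrite -mulr_suml -(ler_pM2l c0) mulrA.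
have -> : c * (\sum_(j < r) (1 - c) ^+ j) = 1 - (1 - c) ^+ r.
  by have := subrX1 (1 - c) r; lra.
rewrite mulrBl mul1r lerBlDl -lerBlDr; apply: decr_le => u.
case: eqP => [->|_]; first by rewrite mulr1 subr_ge0.
by rewrite mulr0 subr0.
Qed.

Lemma link_poly_scale (i : vert G) (c : R) (x : vert G -> R) :
  link_poly i (fun u => c * x u) = c ^+ r.-1 * link_poly i x.
Proof.
rewrite /link_poly mulr_sumr; apply: eq_bigr => e /andP[/Gr eE ie].
by rewrite prodrMl -eE (cardsD1 i e) ie.
Qed.

Lemma exists_scaled_optimum (n : R) : 0 < n -> 0 < lagrangian R G ->
  exists (z : vert G -> R) (i : vert G),
    [/\ forall u, 0 <= z u <= z i, \sum_u z u = n,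
        lagrange_poly z = n ^+ r * lagrangian R G &
        n ^+ r.-1 * (r%:R * lagrangian R G) <= link_poly i z].
Proof.
move=> n0 /lagrangian_gt0_attained[x xS xE]; have [x0 x1] := xS.
have [i xi xmax] := simplex_max xS.
exists (fun u => n * x u), i; split=> [u|||].
- by rewrite mulr_ge0 ?(ltW n0) //= ler_pM2l.
- by rewrite -mulr_sumr x1 mulr1.
- by rewrite (lagrange_poly_scale _ _ Gr) xE.
- rewrite link_poly_scale ler_wpM2l ?exprn_ge0 ?(ltW n0) //.
  exact: lagrangian_le_link_poly.
Qed.

End Optimum.

Definition has_matching (T : Type) (m : nat) (e : rel T) : Prop :=
  exists M : ('I_m * 'I_2)%type -> T,
    injective M /\ forall c, e (M (c, ord0)) (M (c, ord_max)).

Definition quad_form (R : pzRingType) (T : finType) (e : rel T)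
    (y : T -> R) : R :=
  \sum_u \sum_v (e u v)%:R * (y u * y v).

Definition touches_only (T : eqType) (i j u v : T) : bool :=
  ((u == i) || (v == i)) && ~~ ((u == j) || (v == j)).

Definition shift_gain (T : finType) (i j : T) (e : rel T) : rel T := fun u v =>
  [&& touches_only i j u v, ~~ e u v & e (tperm i j u) (tperm i j v)].

(* The compression of extremal set theory: an edge at [j] is moved to [i]
   whenever the corresponding edge at [i] is missing. *)
Definition shift (T : finType) (i j : T) (e : rel T) : rel T := fun u v =>
  shift_gain i j e u v ||
    (e u v && ~~ shift_gain i j e (tperm i j u) (tperm i j v)).

Section Shift.

Variables (T : finType) (i j : T) (e : rel T).
Hypotheses (e_sym : symmetric e) (e_irr : irreflexive e).

Lemma shift_gain_sym : symmetric (shift_gain i j e).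
Proof.
move=> u v; rewrite /shift_gain /touches_only e_sym (e_sym (tperm i j v)).
by rewrite (orbC (u == i)) (orbC (u == j)).
Qed.

Lemma shift_sym : symmetric (shift i j e).
Proof.
move=> u v; rewrite /shift e_sym shift_gain_sym.
by rewrite (shift_gain_sym (tperm i j v)).
Qed.

Lemma shift_irr : irreflexive (shift i j e).
Proof. by move=> u; rewrite /shift /shift_gain !e_irr !andbF. Qed.

Lemma touches_only_tperm (u v : T) :
  touches_only i j (tperm i j u) (tperm i j v) = touches_only j i u v.
Proof.
have tpermE a b : (tperm i j a == b) = (a == tperm i j b).
  by rewrite -{1}(tpermK i j b) (inj_eq (@perm_inj _ _)).
by rewrite /touches_only !tpermE tpermL tpermR.
Qed.

(* If a matching of the shifted graph uses a gained edge, then the transposition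
   of [i] and [j] maps the whole matching into [e]. *)
Lemma shift_has_matching (m : nat) :
  has_matching m (shift i j e) -> has_matching m e.
Proof.
case=> M [M_inj Me].
have [e_M|/existsNP[c0 /negP not_e]] :=
  pselect (forall c, e (M (c, ord0)) (M (c, ord_max))); first by exists M.
have /and3P[touch_i _ gained] : shift_gain i j e (M (c0, ord0)) (M (c0, ord_max)).
  by move: (Me c0); rewrite /shift (negPf not_e) orbF.
exists (fun p => tperm i j (M p)); split=> [p q /perm_inj /M_inj //|c].
have [-> //|c_neq] := eqVneq c c0.
have M_neq_i a : M (c, a) != i.
  apply/eqP => Mi; move: touch_i => /andP[/orP[]/eqP Mi0 _]; move: c_neq;
    by rewrite -Mi0 in Mi; case: (M_inj _ _ Mi) => -> _; rewrite eqxx.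
move: (Me c); rewrite /shift /shift_gain touches_only_tperm !tpermK /touches_only.
rewrite !(negPf (M_neq_i _)) /= andbT; move=> /andP[eM]; rewrite eM.
have [_|/norP[M0 M1] _] := boolP (_ || _); first by rewrite andbT negbK.
by rewrite !tpermD // eq_sym.
Qed.

Lemma quad_form_shift (R : realFieldType) (y : T -> R) :
  let tau := tperm i j in
  quad_form (shift i j e) y = quad_form e y +
    \sum_u \sum_v (shift_gain i j e u v)%:R *
      (y u * y v - y (tau u) * y (tau v)).
Proof.
move=> tau; rewrite /quad_form !pair_big /=.
have shiftE u v : (shift i j e u v)%:R = (e u v)%:R +
    (shift_gain i j e u v)%:R - (shift_gain i j e (tau u) (tau v))%:R :> R.
  rewrite /shift /shift_gain !tpermK -/tau.
  case: (e u v); case: (e (tau u) (tau v)); case: (touches_only i j u v);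
    case: (touches_only i j (tau u) (tau v)) => /=; lra.
under eq_bigr do rewrite shiftE mulrBl mulrDl.
rewrite sumrB big_split /= -addrA; congr (_ + _).
have tau_inj : injective (fun p : T * T => (tau p.1, tau p.2)).
  by case=> u v [u' v'] /= [/perm_inj -> /perm_inj ->].
rewrite [X in _ - X](reindex_inj tau_inj) /=.
under [X in _ - X]eq_bigr do rewrite !tpermK.
by rewrite -sumrB; apply: eq_bigr => p _; rewrite mulrBr.
Qed.

Lemma shift_gain_mul_ge0 (R : realFieldType) (y : T -> R) (u v : T) :
  (forall w, 0 <= y w) -> y j <= y i ->
  0 <= (shift_gain i j e u v)%:R *
    (y u * y v - y (tperm i j u) * y (tperm i j v)).
Proof.
move=> y0 yji; case: (boolP (shift_gain _ _ _ _ _)) => [|_]; last by rewrite mul0r.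
case/and3P=> /andP[/orP[]/eqP-> /norP[uj vj]] _ gained; rewrite mul1r subr_ge0.
  have vi : v != i by apply: contraTneq gained => ->; rewrite e_irr.
  by rewrite tpermL tpermD 1?eq_sym // ler_wpM2r.
have ui : u != i by apply: contraTneq gained => ->; rewrite e_irr.
by rewrite tpermL tpermD 1?eq_sym // ler_wpM2l.
Qed.

Lemma quad_form_shift_ge (R : realFieldType) (y : T -> R) :
  (forall w, 0 <= y w) -> y j <= y i ->
  quad_form e y <= quad_form (shift i j e) y.
Proof.
move=> y0 yji; rewrite quad_form_shift lerDl.
by do 2 (apply: sumr_ge0 => ? _); exact: shift_gain_mul_ge0.
Qed.

Lemma quad_form_shift_gt (R : realFieldType) (y : T -> R) (u : T) :
  (forall w, 0 < y w) -> y j < y i -> u != i -> u != j -> e j u -> ~~ e i u ->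
  quad_form e y < quad_form (shift i j e) y.
Proof.
move=> y0 yji ui uj eju eiu; rewrite quad_form_shift ltrDl.
have gain_ge0 a b : 0 <= (shift_gain i j e a b)%:R *
    (y a * y b - y (tperm i j a) * y (tperm i j b)).
  by apply: shift_gain_mul_ge0 => [w|]; exact: ltW.
rewrite (bigD1 i) //= (bigD1 u) //= ltr_pwDl ?sumr_ge0 // => [|a _]; last first.
  exact: sumr_ge0.
have ij : i != j by apply: contraTneq yji => ->; rewrite ltxx.
rewrite ltr_pwDl ?sumr_ge0 // /shift_gain /touches_only eqxx (negPf uj) (negPf ij).
rewrite tpermL tpermD 1?eq_sym // eiu eju /= mul1r -mulrBl.
by rewrite mulr_gt0 // subr_gt0.
Qed.

End Shift.

Lemma exists_max_rel (R : realDomainType) (T : finType) (P : rel T -> Prop)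
    (f : rel T -> R) (e : rel T) :
  P e -> exists2 e', P e' & forall e'', P e'' -> f e'' <= f e'.
Proof.
pose rel_of (E : {set T * T}) : rel T := fun u v => (u, v) \in E.
pose set_of (d : rel T) : {set T * T} := [set p | d p.1 p.2].
have set_ofK d : rel_of (set_of d) = d.
  by apply/funext => u; apply/funext => v; rewrite /rel_of inE.
move=> Pe; have P0 : `[< P (rel_of (set_of e)) >] by apply/asboolP; rewrite set_ofK.
have [E /asboolP PE maxE] :=
  @arg_maxP _ R _ _ (fun E => `[< P (rel_of E) >]) (fun E => f (rel_of E)) P0.
exists (rel_of E) => // d Pd; rewrite -(set_ofK d); apply: maxE.
by apply/asboolP; rewrite set_ofK.
Qed.

Lemma exists_decreasing_rank (R : realDomainType) (T : finType) (y : T -> R) :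
  exists2 rank : T -> 'I_#|T|, injective rank &
    forall u v, (rank u <= rank v)%N -> y v <= y u.
Proof.
pose geq u v := y v <= y u.
have geq_trans : transitive geq by move=> v u w uv vw; exact: le_trans vw uv.
have geq_refl : reflexive geq by move=> u; exact: lexx.
have geq_total : total geq by move=> u v; exact: le_total.
pose s := sort geq (enum T).
have s_mem u : u \in s by rewrite mem_sort mem_enum.
have lt_index u : (index u s < #|T|)%N.
  by have := s_mem u; rewrite -index_mem size_sort -cardE.
exists (fun u => Ordinal (lt_index u)) => [u v [uv]|u v].
  exact: index_inj uv.
by apply: (sorted_leq_index geq_trans geq_refl); rewrite ?sort_sorted ?s_mem.
Qed.

Definition stable (T : finType) (rank : T -> nat) (e : rel T) : Prop :=
  forall i j u, (rank i < rank j)%N -> u != i -> u != j -> e j u -> e i u.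

Definition dominated (T : finType) (S B : {set T}) (e : rel T) : Prop :=
  forall u v, e u v -> [|| u \in S, v \in S | (u \in B) && (v \in B)].

Section Compression.

Variables (R : realFieldType) (T : finType) (m : nat) (rank : T -> 'I_#|T|).
Hypothesis rank_inj : injective rank.

(* Among the admissible graphs, one that is extremal for weights strictly
   decreasing with the rank is stable, since otherwise a shift improves it. *)
Lemma exists_stable (e : rel T) (y : T -> R) :
  symmetric e -> irreflexive e -> ~ has_matching m e ->
  (forall u, 0 <= y u) -> (forall u v, (rank u <= rank v)%N -> y v <= y u) ->
  exists e' : rel T, [/\ symmetric e', irreflexive e', ~ has_matching m e',
    stable rank e' & quad_form e y <= quad_form e' y].
Proof.
move=> e_sym e_irr e_free y0 y_decr.
pose admissible (d : rel T) := [/\ symmetric d, irreflexive d,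
  ~ has_matching m d & quad_form e y <= quad_form d y].
pose w u : R := (#|T| - rank u)%:R.
have w0 u : 0 < w u by rewrite ltr0n subn_gt0.
have [|d [d_sym d_irr d_free d_ge] d_max] :=
  @exists_max_rel R T admissible (fun d => quad_form d w) e; first by [].
exists d; split=> // i j u ij ui uj dju; apply/negPn/negP => diu.
have wji : w j < w i by rewrite ltr_nat; have := ltn_ord (rank j); lia.
have := quad_form_shift_gt d_irr w0 wji ui uj dju diu.
rewrite ltNge d_max //; split; [exact: shift_sym|exact: shift_irr| |].
  by move/shift_has_matching.
by apply: le_trans d_ge (quad_form_shift_ge _ y0 _) => //; apply/y_decr/ltnW.
Qed.

Let vertex_of_rank (a : nat) : (a < #|T|)%N -> exists u, rank u = a :> nat.
Proof.
have /inj_card_bij[|f fK rankK] := rank_inj; first by rewrite card_ord.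
by move=> aT; exists (f (Ordinal aT)); rewrite rankK.
Qed.

(* Otherwise the vertices of rank [c] and [2 m - 1 - c] are adjacent for every
   [c < m], and these pairs form a matching. *)
Lemma stable_dominated (e : rel T) :
  symmetric e -> stable rank e -> ~ has_matching m e ->
  exists2 s, (s < m)%N & forall u v, (rank u < rank v)%N -> e u v ->
    (rank u < s)%N || (rank v < 2 * m - 1 - s)%N.
Proof.
move=> e_sym e_stable e_free; have [Tsmall|Tlarge] := ltnP #|T| (2 * m).
  exists 0%N => [|u v _ _]; first by lia.
  by have := ltn_ord (rank v); lia.
have /choice[lo loE] (c : 'I_m) : exists u, rank u = c :> nat.
  by apply: vertex_of_rank; have := ltn_ord c; lia.
have /choice[hi hiE] (c : 'I_m) : exists u, rank u = (2 * m - 1 - c)%N :> nat.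
  by apply: vertex_of_rank; have := ltn_ord c; lia.
pose M (p : 'I_m * 'I_2) := if p.2 == ord0 then lo p.1 else hi p.1.
have M_inj : injective M.
  move=> [c b] [c' b'] /(congr1 (fun u => nat_of_ord (rank u))); rewrite /M /=.
  have := (ltn_ord b', ltn_ord b); have := (ltn_ord c', ltn_ord c).
  rewrite -!val_eqE => -[cm c'm] -[b2 b'2] rankE.
  by congr (_, _); apply: val_inj; move: rankE; do 2 case: eqP;
    rewrite ?(loE, hiE) /=; lia.
have /existsNP[c /negP not_e] : ~ forall c, e (lo c) (hi c).
  by move=> e_M; apply: e_free; exists M.
have cm := ltn_ord c; exists c => // u v uv euv.
rewrite -[_ || _]negbK; apply: contra not_e => /norP[]; rewrite -!leqNgt => cu vc.
have neq a b : (rank a < rank b)%N -> a != b.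
  by apply: contraTneq => ->; rewrite ltnn.
have e_lower i j w : (rank i <= rank j)%N -> w != i -> w != j -> e j w -> e i w.
  by rewrite leq_eqVlt => /orP[/eqP/val_inj/rank_inj->|/e_stable]; auto.
have e_lo : e (lo c) v.
  by apply: (e_lower _ u) => //; rewrite ?loE // eq_sym neq ?loE //; lia.
rewrite e_sym; apply: (e_lower _ v); rewrite 1?e_sym ?hiE ?neq ?loE ?hiE //; lia.
Qed.

Lemma card_rank_interval (p q : nat) :
  (#|[set u | p <= rank u < q]%N| <= q - p)%N.
Proof.
rewrite -[leqRHS](size_iota p) cardE -(size_map (val \o rank)).
apply: uniq_leq_size.
  by rewrite map_inj_uniq ?enum_uniq // => u v /val_inj/rank_inj.
move=> _ /mapP[u + ->]; rewrite mem_enum inE mem_iota => /andP[pu uq].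
by rewrite pu subnKC // (leq_trans pu (ltnW uq)).
Qed.

End Compression.

Lemma matching_free_dominated (R : realFieldType) (T : finType) (m : nat)
    (e : rel T) (y : T -> R) :
  symmetric e -> irreflexive e -> ~ has_matching m e -> (forall u, 0 <= y u) ->
  exists (s : nat) (S B : {set T}) (e' : rel T),
    [/\ (s < m)%N /\ irreflexive e', dominated S B e',
        [disjoint S & B], (#|S| <= s)%N /\ (#|B| <= 2 * m - 1 - 2 * s)%N &
        quad_form e y <= quad_form e' y].
Proof.
move=> e_sym e_irr e_free y0.
have [rank rank_inj y_decr] := exists_decreasing_rank y.
have [e' [e'_sym e'_irr e'_free e'_stable e_le]] :=
  exists_stable e_sym e_irr e_free y0 y_decr.
have [s sm e'_dom] := stable_dominated rank_inj e'_sym e'_stable e'_free.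
exists s, [set u | 0 <= rank u < s]%N, [set u | s <= rank u < 2 * m - 1 - s]%N, e'.
split=> //.
- move=> u v euv; rewrite !inE.
  have [uv|vu|/val_inj/rank_inj uv] := ltngtP (rank u) (rank v).
  + by have := e'_dom u v uv euv; lia.
  + by have := e'_dom v u vu; rewrite e'_sym => /(_ euv); lia.
  + by rewrite uv e'_irr in euv.
- by rewrite -setI_eq0; apply/eqP/setP => u; rewrite !inE; lia.
- split; first by rewrite -[leqRHS]subn0; exact: card_rank_interval.
  by rewrite (leq_trans (card_rank_interval _ _ _)) //; lia.
Qed.

Lemma sqr_sum_le_card (R : realFieldType) (T : finType) (A : {set T}) (y : T -> R)
    (n : nat) :
  (#|A| <= n)%N -> (\sum_(u in A) y u) ^+ 2 <= n%:R * \sum_(u in A) y u ^+ 2.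
Proof.
set S := \sum_(u in A) y u; set S2 := \sum_(u in A) y u ^+ 2 => An.
have [n0|n_gt0] := posnP n.
  by rewrite /S big_pred0 ?expr0n ?n0 ?mul0r // => u; apply: card0_eq; lia.
have nR : 0 < n%:R :> R by rewrite ltr0n.
have : 0 <= \sum_(u in A) (n%:R * y u - S) ^+ 2.
  by apply: sumr_ge0 => u _; exact: sqr_ge0.
have sqrE u : (n%:R * y u - S) ^+ 2 =
    n%:R ^+ 2 * y u ^+ 2 + (- 2 * n%:R * S * y u + S ^+ 2) by ring.
under eq_bigr do rewrite sqrE.
rewrite !big_split /= -!mulr_sumr sumr_const -/S -/S2 -mulr_natl.
have card_le : #|A|%:R * S ^+ 2 <= n%:R * S ^+ 2.
  by rewrite ler_wpM2r ?sqr_ge0 // ler_nat.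
by move=> sqr_sum_ge0; rewrite -(ler_pM2l nR); lra.
Qed.

Lemma sum_le_card (R : realFieldType) (T : finType) (A : {set T}) (y : T -> R)
    (a : R) (n : nat) :
  0 <= a -> (forall u, y u <= a) -> (#|A| <= n)%N -> \sum_(u in A) y u <= n%:R * a.
Proof.
move=> a0 ya An; apply: (@le_trans _ _ (#|A|%:R * a)).
  by rewrite mulr_natl -sumr_const; apply: ler_sum.
by rewrite ler_wpM2r // ler_nat.
Qed.

Lemma sum_set_le (R : realFieldType) (T : finType) (A : {pred T}) (y : T -> R) :
  (forall u, 0 <= y u) -> \sum_(u in A) y u <= \sum_u y u.
Proof. by move=> y0; rewrite [leRHS](bigID (mem A)) /= lerDl sumr_ge0. Qed.

Section DominatedGraph.

Variables (R : realFieldType) (T : finType) (e : rel T) (S B : {set T}).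
Variables (y : T -> R) (s b : nat).
Hypotheses (e_irr : irreflexive e) (e_dom : dominated S B e).
Hypotheses (disSB : [disjoint S & B]) (y0 : forall u, 0 <= y u).
Hypotheses (s_gt0 : (0 < s)%N) (b_gt0 : (0 < b)%N).
Hypotheses (cardS : (#|S| <= s)%N) (cardB : (#|B| <= b)%N).

Let sumS := \sum_(u in S) y u.
Let sumB := \sum_(u in B) y u.
Let total := \sum_u y u.

Lemma quad_form_dominated_le :
  quad_form e y <= 2 * sumS * total - sumS ^+ 2 + sumB ^+ 2
    - \sum_(u in S) y u ^+ 2 - \sum_(u in B) y u ^+ 2.
Proof.
pose p u := if u \in S then y u else 0; pose q u := if u \in B then y u else 0.
pose F u v := p u * y v + y u * p v - p u * p v + q u * q v.
have sqr_mask (A : {set T}) : \sum_(u in A) y u ^+ 2 =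
    \sum_u (if u \in A then y u else 0) ^+ 2.
  by rewrite big_mkcond; apply: eq_bigr => u _; case: ifP; rewrite ?expr0n.
have -> : 2 * sumS * total - sumS ^+ 2 + sumB ^+ 2 = \sum_u \sum_v F u v.
  have [-> ->] : sumS = \sum_u p u /\ sumB = \sum_u q u.
    by rewrite /sumS /sumB big_mkcond [\sum_(u in B) _]big_mkcond.
  rewrite /F; under [RHS]eq_bigr do rewrite big_split sumrB big_split /=.
  rewrite big_split sumrB big_split /= -!big_distrlr /= -/total; ring.
have diagE u : p u ^+ 2 + q u ^+ 2 = F u u.
  by rewrite /F /p /q; case: ifP; case: ifP => _ _; ring.
rewrite !sqr_mask -addrA -opprD -big_split -sumrB /=; apply: ler_sum => u _.
rewrite diagE (bigD1 u) //= e_irr mul0r add0r.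
rewrite [leRHS]addrC [X in _ + X](bigD1 u) //= addKr.
apply: ler_sum => v _; rewrite /F /p /q.
have [yu yv] := (y0 u, y0 v); have yuv := mulr_ge0 yu yv.
have dis w : ~~ ((w \in S) && (w \in B)).
  by apply/negP => /andP[/(disjointFr disSB)->].
have /implyP := @e_dom u v; move: (dis u) (dis v).
case: (e u v); case: (u \in S); case: (v \in S); case: (u \in B); case: (v \in B);
  rewrite //= => _ _ _; lra.
Qed.

Let sumSB_le : sumS + sumB <= total.
Proof. by rewrite /sumS /sumB -bigU //=; exact: sum_set_le. Qed.

Lemma quad_form_dominated_le_card :
  s%:R * b%:R * quad_form e y <=
    s%:R * b%:R * (2 * sumS * total - sumS ^+ 2 + sumB ^+ 2)
      - b%:R * sumS ^+ 2 - s%:R * sumB ^+ 2.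
Proof.
have sb0 : 0 <= s%:R * b%:R :> R by rewrite mulr_ge0.
have := ler_wpM2l sb0 quad_form_dominated_le.
have := ler_wpM2l (ler0n R b) (sqr_sum_le_card y cardS).
have := ler_wpM2l (ler0n R s) (sqr_sum_le_card y cardB).
by rewrite -/sumS -/sumB; lra.
Qed.

(* Motzkin and Straus: a largest clique has at most [s + b] vertices, and the
   uniform weighting of such a clique is the best one. *)
Lemma quad_form_dominated_le_sqr_sum :
  (s + b)%:R * quad_form e y <= ((s + b)%:R - 1) * total ^+ 2.
Proof.
have sumB0 : 0 <= sumB by exact: sumr_ge0.
have s1 : 1 <= s%:R :> R by rewrite ler1n.
have b1 : 1 <= b%:R :> R by rewrite ler1n.
move: quad_form_dominated_le_card sumSB_le; rewrite natrD.
move: (s%:R : R) (b%:R : R) s1 b1 (quad_form e y) => m n m1 n1 Q.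
move: sumS sumB total sumB0 => x z w z0 Q_le xzw.
have z_part : (n - 1) * z ^+ 2 <= (n - 1) * (w - x) ^+ 2.
  by rewrite ler_wpM2l ?ler_sqr ?nnegrE; lra.
have mn0 : 0 < m * n by rewrite mulr_gt0; lra.
have mnQ : m * n * Q <= m * n * w ^+ 2 - (m * (w - x) ^+ 2 + n * x ^+ 2).
  have : m * ((n - 1) * z ^+ 2) <= m * ((n - 1) * (w - x) ^+ 2).
    by rewrite ler_wpM2l //; lra.
  by lra.
have mn_mulQ : (m + n) * (m * n * Q) <=
    (m + n) * (m * n * w ^+ 2 - (m * (w - x) ^+ 2 + n * x ^+ 2)).
  by rewrite ler_wpM2l //; lra.
by rewrite -(ler_pM2l mn0); have := sqr_ge0 (n * x - m * (w - x)); lra.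
Qed.

(* The bound is the value of the form when all vertices of [S] and [B] have the
   largest allowed weight [a]. *)
Lemma quad_form_dominated_le_capped (a : R) :
  0 <= a -> (forall u, y u <= a) -> (s%:R + 1) * a <= total ->
  quad_form e y <=
    s%:R * a * (2 * total - (s%:R + 1) * a) + b%:R * (b%:R - 1) * a ^+ 2.
Proof.
move=> a0 ya; have sumB0 : 0 <= sumB by exact: sumr_ge0.
have s1 : 1 <= s%:R :> R by rewrite ler1n.
have b1 : 1 <= b%:R :> R by rewrite ler1n.
have := sum_le_card a0 ya cardS; have := sum_le_card a0 ya cardB.
move: quad_form_dominated_le_card; rewrite -/sumS -/sumB.
move: (s%:R : R) (b%:R : R) s1 b1 (quad_form e y) => m n m1 n1 Q.
move: sumS sumB total sumB0 => x z w z0 Q_le za xa ma_le.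
have mn0 : 0 < m * n by rewrite mulr_gt0; lra.
have z_part : m * (n - 1) * z ^+ 2 <= m * (n - 1) * (n * a) ^+ 2.
  have mn1 : 0 <= m * (n - 1) by rewrite mulr_ge0; lra.
  by rewrite ler_wpM2l // ler_sqr ?nnegrE //; lra.
have x_part : 0 <= n * ((m * a - x) * (2 * m * w - (m + 1) * (m * a + x))).
  rewrite !mulr_ge0 ?subr_ge0 //; first lra.
  have : (m + 1) * x <= (m + 1) * (m * a) by rewrite ler_wpM2l //; lra.
  have : m * ((m + 1) * a) <= m * w by rewrite ler_wpM2l //; lra.
  by lra.
by rewrite -(ler_pM2l mn0); lra.
Qed.

End DominatedGraph.

Lemma motzkin_straus_value_le (R : realFieldType) (t n q : R) :
  0 < n -> n <= 2 * t - 2 -> n * q <= (n - 1) * (2 * t - 1) ^+ 2 ->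
  q <= (2 * t - 1) * (2 * t - 2) - 1.
Proof.
move=> n0 n_le nq_le; rewrite -(ler_pM2l n0).
have : n * (2 * t) <= (2 * t - 2) * (2 * t) by rewrite ler_wpM2r //; lra.
by lra.
Qed.

(* The left-hand side increases with [a] up to [a = 1]. *)
Lemma capped_value_le (R : realFieldType) (t a s : R) :
  2 <= t -> 0 <= a -> a <= 1 -> 1 <= s -> s <= t - 1 ->
  s * a * (2 * (2 * t - a) - (s + 1) * a) +
    (2 * t - 1 - 2 * s) * (2 * t - 1 - 2 * s - 1) * a ^+ 2 <=
    (2 * t - 1) * (2 * t - 2) - 1.
Proof.
move=> t2 a0 a1 s1 st; move nE : (2 * t - 1 - 2 * s) => n.
have n1 : 1 <= n by lra.
have slope : 0 <= 4 * t * s + (1 + a) * (n * (n - 1) - s * (s + 3)).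
  have : 0 <= s * (t - 2) by rewrite mulr_ge0; lra.
  have : 0 <= s * (t - 1 - s) by rewrite mulr_ge0; lra.
  have : (1 + a) * (s * (s + 3)) <= 2 * (s * (s + 3)).
    by rewrite ler_wpM2r ?mulr_ge0 //; lra.
  have : 0 <= (1 + a) * (n * (n - 1)).
    by rewrite mulr_ge0 ?addr_ge0 ?mulr_ge0 //; lra.
  by lra.
have value_at_1 :
    4 * t * s + (n * (n - 1) - s * (s + 3)) <= (2 * t - 1) * (2 * t - 2) - 1.
  have : 0 <= (s - 1) * (4 * t - 3 - 3 * s) by rewrite mulr_ge0; lra.
  by rewrite -nE; lra.
have : 0 <= (1 - a) * (4 * t * s + (1 + a) * (n * (n - 1) - s * (s + 3))).
  by rewrite mulr_ge0; lra.
by lra.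
Qed.

Section MatchingFree.

Variables (R : realFieldType) (T : finType) (t : nat).
Variables (e : rel T) (y : T -> R) (a : R).
Hypotheses (t_ge2 : (2 <= t)%N) (a0 : 0 <= a) (y0a : forall u, 0 <= y u <= a).
Hypothesis y_sum : \sum_u y u = 2 * t%:R - a.

Let y0 u : 0 <= y u. Proof. by case/andP: (y0a u). Qed.
Let ya u : y u <= a. Proof. by case/andP: (y0a u). Qed.

Lemma quad_form_dominating_vertex_le (d : rel T) (s : nat) (S B : {set T}) :
  (0 < s < t)%N -> irreflexive d -> dominated S B d -> [disjoint S & B] ->
  (#|S| <= s)%N -> (#|B| <= 2 * t - 1 - 2 * s)%N ->
  quad_form d y <= (2 * t%:R - 1) * (2 * t%:R - 2) - 1.
Proof.
move=> /andP[s0 st] d_irr d_dom dis cardS cardB.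
have b0 : (0 < 2 * t - 1 - 2 * s)%N by lia.
have bE : (2 * t - 1 - 2 * s)%:R = 2 * t%:R - 1 - 2 * s%:R :> R.
  by rewrite !natrB ?natrM //; lia.
have t2 : 2 <= t%:R :> R by rewrite ler_nat.
have s1 : 1 <= s%:R :> R by rewrite ler1n.
have s_le : s%:R <= t%:R - 1 :> R by rewrite lerBrDr natr1 ler_nat.
have [a1|/ltW a1] := leP 1 a.
  apply: (motzkin_straus_value_le (n := (s + (2 * t - 1 - 2 * s))%:R)).
  - by rewrite ltr0n addn_gt0 s0.
  - by rewrite natrD bE; lra.
  have := quad_form_dominated_le_sqr_sum d_irr d_dom dis y0 s0 b0 cardS cardB.
  move/le_trans; apply.
  rewrite ler_wpM2l ?subr_ge0 ?ler1n ?addn_gt0 ?s0 //.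
  by rewrite ler_sqr ?nnegrE ?sumr_ge0 // ?y_sum; lra.
have := quad_form_dominated_le_capped d_irr d_dom dis y0 s0 b0 cardS cardB a0 ya.
rewrite bE y_sum => /(_ _)/le_trans; apply; last exact: capped_value_le.
have : (s%:R + 2) * a <= (s%:R + 2) * 1 by rewrite ler_wpM2l //; lra.
by lra.
Qed.

(* If some vertex dominates, the form is below its maximum by at least [1];
   otherwise the compressed graph lives on [2 t - 1] vertices. *)
Lemma quad_form_matching_free_le :
  symmetric e -> irreflexive e -> ~ has_matching t e ->
  quad_form e y <= (2 * t%:R - 1) * (2 * t%:R - 2) - 1 \/
  exists2 B : {set T}, (#|B| <= 2 * t - 1)%N &
    (2 * t%:R - 1) * quad_form e y <= (2 * t%:R - 2) * (\sum_(u in B) y u) ^+ 2.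
Proof.
move=> e_sym e_irr e_free.
have [s [S [B [d [[st d_irr] d_dom dis [cardS cardB] /le_trans le_d]]]]] :=
  matching_free_dominated e_sym e_irr e_free y0.
have [s0|s0] := posnP s; last first.
  left; apply: le_d.
  by apply: quad_form_dominating_vertex_le cardS cardB => //; rewrite s0.
right; exists B; first by rewrite s0 subn0 in cardB.
have := le_d _ (quad_form_dominated_le d_irr d_dom dis y0).
have := sqr_sum_le_card y cardB.
have -> : S = set0 by apply/eqP; rewrite -cards_eq0 -leqn0 -s0.
rewrite !big_set0 s0 muln0 subn0 natrB ?natrM; last by lia.
have t2 : 2 <= t%:R :> R by rewrite ler_nat.
move: (quad_form e y) (\sum_(u in B) y u) (\sum_(u in B) y u ^+ 2).
move=> Q z z2 z2_ge Q_le.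
have : (2 * t%:R - 1) * Q <= (2 * t%:R - 1) * (z ^+ 2 - z2).
  by rewrite ler_pM2l //; lra.
by lra.
Qed.

End MatchingFree.
Lemma exists_block_injection (T : finType) (t m : nat) (A B : {set T}) :
  (0 < m)%N -> #|A| = m -> [disjoint A & B] -> (t.-1 * m <= #|B|)%N ->
  exists2 M : 'I_t * 'I_m -> T, injective M &
    forall c b, M (c, b) \in if val c == 0%N then A else B.
Proof.
move=> m0 cardA dis cardB.
have [x _] : exists x, x \in A by apply/card_gt0P; rewrite cardA.
pose L := enum A ++ enum B.
have L_uniq : uniq L.
  rewrite cat_uniq !enum_uniq andbT /=; apply/hasPn => v; rewrite !mem_enum => vB.
  by rewrite (disjointFl dis vB).
have lt_L (p : 'I_t * 'I_m) : (p.1 * m + p.2 < size L)%N.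
  rewrite size_cat -!cardE cardA; case: p => c b /=.
  by have := ltn_ord c; have := ltn_ord b; nia.
exists (fun p : 'I_t * 'I_m => nth x L (p.1 * m + p.2)).
  move=> [c b] [c' b'] /eqP; rewrite nth_uniq ?(lt_L (c, b)) ?(lt_L (c', b')) //.
  move=> /eqP/(congr1 (edivn^~ m)) /=.
  by rewrite !edivn_eq // => -[/val_inj-> /val_inj->].
move=> c b; have := lt_L (c, b); rewrite /= nth_cat size_cat -!cardE cardA.
case: eqVneq => [->|c0] ltL.
  by rewrite mul0n add0n ltn_ord -mem_enum mem_nth // -cardE cardA.
have mc : (m <= c * m + b)%N by nia.
by rewrite ltnNge mc -mem_enum mem_nth // -cardE; lia.
Qed.

Section LinearStars.

Variable G : hypergraph.
Implicit Types (i : vert G) (W : {set vert G}).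

Lemma linear_star_subgraph (r t : nat) i (M : 'I_t * 'I_r.-1 -> vert G) :
  injective M -> (forall p, M p != i) ->
  (forall c, i |: [set M (c, b) | b : 'I_r.-1] \in edges G) ->
  subgraph_of (linear_star r t) G.
Proof.
move=> M_inj M_neq M_edge.
pose f (o : vert (linear_star r t)) := if o is Some p then M p else i.
exists f; split=> [[p|] [q|] //= fE|_ /imsetP[c _ ->]].
- by rewrite (M_inj _ _ fE).
- by have := M_neq p; rewrite fE eqxx.
- by have := M_neq q; rewrite -fE eqxx.
rewrite imsetU1 /=; rewrite (_ : f @: _ = [set M (c, b) | b : 'I_r.-1]) //.
apply/setP => v; apply/imsetP/imsetP => [[[[c' b]|]]|[b _ ->]].
- by rewrite inE => /eqP-> ->; exists b.
- by rewrite inE.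
- by exists (Some (c, b)); rewrite ?inE.
Qed.

Lemma linear_star_free_card (r t : nat) :
  (#|vert G| <= t * r.-1)%N -> ~ subgraph_of (linear_star r t) G.
Proof.
move=> cardG [f [/leq_card f_le _]]; move: f_le.
by rewrite card_option card_prod !card_ord ltnNge cardG.
Qed.

Definition clique (r : nat) W : Prop :=
  forall e : {set vert G}, e \subset W -> #|e| = r -> e \in edges G.

(* If [u] lies outside the clique [W], an edge joining [u] to some [w] in [W],
   together with disjoint edges through [w] inside [W], is a linear star. *)
Lemma clique_spanning (r t : nat) W :
  (1 < r)%N -> (0 < t)%N -> uniform r G -> ~ subgraph_of (linear_star r t) G ->
  covers_pairs G -> clique r W -> (t * r.-1 <= #|W|)%N -> W = setT.
Proof.
move=> r1 t0 Gr free cov cliqueW cardW.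
apply/setP => u; rewrite inE; apply/negPn/negP => uW; apply: free.
have [w wW] : exists w, w \in W.
  by apply/card_gt0P; rewrite (leq_trans _ cardW) // muln_gt0; lia.
have [e [eG ue we]] : exists e, [/\ e \in edges G, u \in e & w \in e].
  by apply: cov; apply: contraNneq uW => ->.
have card_ew : #|e :\ w| = r.-1.
  by have := cardsD1 w e; rewrite we (Gr e eG); lia.
have card_We : (t.-1 * r.-1 <= #|W :\: e|)%N.
  have : (#|W :&: e| <= #|e :\ u|)%N.
    apply: subset_leq_card; apply/subsetP => v; rewrite !inE => /andP[vW ->].
    by rewrite andbT; apply: contraNneq uW => <-.
  have := cardsID e W; have := cardsD1 u e; rewrite ue (Gr e eG); nia.
have dis : [disjoint e :\ w & W :\: e].
  rewrite -setI_eq0; apply/eqP/setP => v; rewrite !inE.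
  by case: (v \in e); rewrite ?andbF.
have [|M M_inj M_in] := exists_block_injection _ card_ew dis card_We; first by lia.
have M_neq p : M p != w.
  case: p => c b; have := M_in c b; case: ifP => _; rewrite !inE => /andP[] //.
  by move=> Me _; apply: contraNneq Me => ->.
apply: (@linear_star_subgraph _ _ w M) => // c; set F := _ |: _.
have cardF : #|F| = r.
  rewrite cardsU1 card_imset ?card_ord => [|b b' /M_inj[]//].
  case: imsetP => [[b _ wM]|_]; last by lia.
  by have := M_neq (c, b); rewrite wM eqxx.
case: (eqVneq (val c) 0%N) => c0.
  suff -> : F = e by [].
  apply/eqP; rewrite eqEcard cardF (Gr e eG) leqnn andbT; apply/subsetP => v.
  rewrite !inE => /orP[/eqP-> //|/imsetP[b _ ->]].
  by have := M_in c b; rewrite c0 !inE => /andP[].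
apply: cliqueW => //; apply/subsetP => v.
rewrite !inE => /orP[/eqP-> //|/imsetP[b _ ->]].
by have := M_in c b; rewrite (negPf c0) !inE => /andP[].
Qed.

Lemma isomorphic_complete (r n : nat) :
  uniform r G -> clique r setT -> #|vert G| = n -> isomorphic G (complete r n).
Proof.
move=> Gr cliqueG <-; exists enum_rank; split.
  by exists enum_val; [exact: enum_rankK|exact: enum_valK].
move=> e; rewrite inE card_imset; last exact: enum_rank_inj.
by apply/eqP/idP => [|/Gr //]; exact: cliqueG.
Qed.

End LinearStars.

Lemma cards3 (T : finType) (u v w : T) :
  (#|[set u; v; w]| == 3%N) = [&& u != v, u != w & v != w].
Proof.
rewrite -setUA !cardsU1 cards1 !inE negb_or.
by case: (u == v); case: (u == w); case: (v == w).
Qed.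

Definition link (G : hypergraph) (i : vert G) : rel (vert G) :=
  fun u v => [set i; u; v] \in edges G.

Section Link.

Variables (G : hypergraph) (i : vert G).
Hypothesis G3 : uniform 3 G.

Lemma link_neq (u v : vert G) : link i u v -> [&& i != u, i != v & u != v].
Proof. by move=> /G3/eqP; rewrite cards3. Qed.

Lemma link_sym : symmetric (link i).
Proof. by move=> u v; rewrite /link setUAC. Qed.

Lemma link_irr : irreflexive (link i).
Proof. by move=> u; apply/negP => /link_neq; rewrite eqxx !andbF. Qed.

Lemma link_matching_star (t : nat) :
  has_matching t (link i) -> subgraph_of (linear_star 3 t) G.
Proof.
have ord2P (b : 'I_2) : b = ord0 \/ b = ord_max.
  by case: b => -[|[|//]] ?; [left|right]; apply: val_inj.
case=> M [M_inj Me]; apply: (@linear_star_subgraph G 3 t i M) => // [[c b]|c].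
  have := link_neq (Me c); rewrite ![i == _]eq_sym.
  by have [-> /and3P[]|-> /and3P[]] := ord2P b.
rewrite (_ : _ |: _ = [set i; M (c, ord0); M (c, ord_max)]) ?[_ \in _]Me //.
rewrite -setUA; congr (_ :|: _); apply/setP => v; rewrite !inE.
apply/imsetP/idP => [[b _ ->]|/orP[]/eqP->]; [|by exists ord0|by exists ord_max].
by have [->|->] := ord2P b; rewrite eqxx ?orbT.
Qed.

Lemma quad_form_link (R : realType) (x : vert G -> R) :
  quad_form (link i) x = 2 * link_poly i x.
Proof.
pose edge_of (p : vert G * vert G) := [set i; p.1; p.2].
rewrite /quad_form pair_big /=; under eq_bigr => p _ do rewrite mulr_natl mulrb.
rewrite -big_mkcond.
rewrite (partition_big edge_of (fun e => (e \in edges G) && (i \in e))) /=.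
  2: by move=> p link_p; rewrite [_ \in edges G]link_p !inE eqxx.
rewrite /link_poly mulr_sumr; apply: eq_bigr => e /andP[eG ie].
have /eqP/cards2P[u [v [uv euv]]] : #|e :\ i| = 2%N.
  by have := cardsD1 i e; rewrite ie (G3 eG); lia.
have eE : e = [set i; u; v] by rewrite -setUA -euv setD1K.
have pairs p : link i p.1 p.2 && (edge_of p == e) = (p \in [set (u, v); (v, u)]).
  case: p => a b; rewrite !inE /= !xpair_eqE /edge_of /=.
  apply/andP/orP => [[/link_neq/and3P[ia ib ab] /eqP abE]|].
    have : (a \in e :\ i) && (b \in e :\ i).
      by rewrite -abE !inE !eqxx !orbT (eq_sym a) ia (eq_sym b) ib.
    rewrite euv !inE; case/andP => /orP[]/eqP au /orP[]/eqP bu; subst a b.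
    - by rewrite eqxx in ab.
    - by left; rewrite !eqxx.
    - by right; rewrite !eqxx.
    - by rewrite eqxx in ab.
  case=> /andP[/eqP-> /eqP->]; first by rewrite /link -eE.
  by rewrite link_sym setUAC /link -eE.
under eq_bigl do rewrite pairs.
rewrite big_setU1 ?big_set1 /=; last by rewrite inE xpair_eqE (negPf uv).
rewrite euv big_setU1 ?inE // big_set1 /=; ring.
Qed.

Lemma link_poly_le_sqr_sum (R : realType) (x : vert G -> R) :
  (forall u, 0 <= x u) -> link_poly i x <= (\sum_u x u) ^+ 2 / 2.
Proof.
move=> x0; rewrite ler_pdivlMr // mulrC -quad_form_link expr2 big_distrlr.
do 2 (apply: ler_sum => ? _); rewrite ler_piMl ?mulr_ge0 //.
by rewrite lern1 leq_b1.
Qed.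

End Link.

Lemma lagrange_poly_not_clique (R : realType) (G : hypergraph) (r : nat)
    (W : {set vert G}) (x : vert G -> R) (a : R) :
  uniform r G -> 0 <= a -> (forall u, 0 <= x u <= a) -> ~ clique r W ->
  lagrange_poly x <= a ^+ r * ('C(#|W|, r)%:R - 1) +
    \sum_(u | u \notin W) x u * link_poly u x.
Proof.
move=> Gr a0 x0a not_clique.
have x0 u : 0 <= x u by case/andP: (x0a u).
rewrite /lagrange_poly (bigID (fun e : {set vert G} => e \subset W)) /= lerD //.
  have /existsNP[e /not_implyP[eW /not_implyP[er /negP eG]]] := not_clique.
  have lt_bin : (#|[set d in edges G | d \subset W]| < 'C(#|W|, r))%N.
    rewrite -cards_draws; apply/proper_card/properP; split.
      by apply/subsetP => d; rewrite !inE => /andP[/Gr-> ->]; rewrite eqxx.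
    by exists e; rewrite !inE ?eW ?er ?eqxx // andbT (negPf eG).
  apply: (@le_trans _ _ (\sum_(d in edges G | d \subset W) a ^+ r)).
    apply: ler_sum => d /andP[/Gr dr _]; rewrite -dr -prodr_const.
    by apply: ler_prod => u _.
  rewrite sumr_const -[leLHS]mulr_natr ler_wpM2l ?exprn_ge0 //.
  rewrite lerBrDr natr1 ler_nat; apply: leq_trans lt_bin.
  rewrite ltnS subset_leq_card //.
  by apply/subsetP => d; rewrite inE.
under [leRHS]eq_bigr do rewrite mulr_sumr.
rewrite (exchange_big_dep (mem (edges G))) /=; last by move=> u e _ /andP[].
rewrite [leRHS](bigID (fun e : {set vert G} => e \subset W)) /= ler_wpDl //.
  by do 2 (apply: sumr_ge0 => ? _); rewrite mulr_ge0 // prodr_ge0.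
apply: ler_sum => e /andP[eG /subsetPn[u ue uW]].
rewrite [leRHS](bigD1 u) /=; last by rewrite uW eG ue.
rewrite -big_setD1 // lerDl; apply: sumr_ge0 => v _.
by rewrite mulr_ge0 // prodr_ge0.
Qed.

Lemma lagrangian_complete_ge (R : realType) (r n : nat) :
  (0 < n)%N -> 'C(n, r)%:R / n%:R ^+ r <= lagrangian R (complete r n).
Proof.
move=> n0; have nR : n%:R != 0 :> R by rewrite pnatr_eq0 -lt0n.
have uniform_weights : simplex (fun _ : vert (complete r n) => n%:R^-1 : R).
  split=> [_|]; first by rewrite invr_ge0.
  by rewrite sumr_const card_ord -[LHS]mulr_natl divff.
apply: le_trans (lagrange_poly_le_lagrangian uniform_weights).
rewrite /lagrange_poly (eq_bigr (fun _ => n%:R^-1 ^+ r)) => [|e].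
  by rewrite sumr_const /= card_draws card_ord -[leRHS]mulr_natl exprVn.
by move/complete_uniform=> <-; rewrite prodr_const.
Qed.

Lemma natr_bin3 (R : comPzRingType) (n : nat) :
  6 * 'C(n, 3)%:R = n%:R * (n%:R - 1) * (n%:R - 2) :> R.
Proof.
have -> : 6 * 'C(n, 3)%:R = (n ^_ 3)%:R :> R by rewrite -bin_ffact mulnC natrM.
rewrite !ffactnS ffactn0 muln1; case: n => [|[|n]].
- by rewrite !mul0n !mul0r.
- by rewrite muln0 subrr mulr0 mul0r.
- by rewrite /= !natrM -![n.+2%:R]natr1 -![n.+1%:R]natr1; ring.
Qed.

(* Any small enough multiple of [t ^- 3] would do. *)
Definition stability_gap (R : realType) (t : nat) : R := (8 * t%:R ^+ 3)^-1.

Lemma stability_gap_gt0 (R : realType) (t : nat) :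
  (0 < t)%N -> 0 < stability_gap R t.
Proof. by move=> t0; rewrite invr_gt0 mulr_gt0 // exprn_gt0 // ltr0n. Qed.

Lemma stability_gap_mul (R : realType) (t : nat) : (2 <= t)%N ->
  [/\ t%:R ^+ 3 * stability_gap R t = 1 / 8,
      t%:R * stability_gap R t <= 1 / 32 & stability_gap R t <= 1 / 64].
Proof.
move=> t2; have gap0 := stability_gap_gt0 R (ltnW t2).
have tR : 2 <= t%:R :> R by rewrite ler_nat.
have half (c : R) : 0 <= c -> c <= t%:R * c / 2.
  by move=> c0; have := ler_wpM2r c0 tR; lra.
have gap3 : t%:R ^+ 3 * stability_gap R t = 1 / 8.
  by rewrite /stability_gap; field; rewrite gt_eqF //; lra.
have := half (t%:R ^+ 2 * stability_gap R t).
have := half (t%:R * stability_gap R t); have := half (stability_gap R t).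
rewrite !mulr_ge0 ?(ltW gap0) //.
by move=> /(_ isT) gap_le /(_ isT) tgap_le /(_ isT) ttgap_le; split=> //; lra.
Qed.

Lemma block_sum_bounds (R : realFieldType) (T : finType) (z : T -> R) (i : T)
    (B : {set T}) (n : nat) :
  (forall u, 0 <= z u <= z i) -> i \notin B -> (#|B| <= n)%N ->
  [/\ 0 <= \sum_(u in B) z u, z i + \sum_(u in B) z u <= \sum_u z u &
    \sum_(u in B) z u <= n%:R * z i].
Proof.
move=> z0i iB cardB.
have z0 u : 0 <= z u by case/andP: (z0i u).
have zi u : z u <= z i by case/andP: (z0i u).
split; [exact: sumr_ge0|by rewrite -big_setU1 //; exact: sum_set_le|].
exact: sum_le_card.
Qed.

Lemma near_extremal_sum_gt (R : realFieldType) (t c q w : R) :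
  2 <= t -> 0 < c <= 1 -> 0 <= w -> (2 * t - 1) * (2 * t - 2) - c < q ->
  (2 * t - 1) * q <= (2 * t - 2) * w ^+ 2 -> 2 * t - 1 - c < w.
Proof.
move=> t2 /andP[c0 c1] w0 q_gt q_le; rewrite ltNge; apply/negP => w_le.
have : (2 * t - 2) * w ^+ 2 <= (2 * t - 2) * (2 * t - 1 - c) ^+ 2.
  by rewrite ler_wpM2l ?ler_sqr ?nnegrE //; lra.
have : (2 * t - 1) * ((2 * t - 1) * (2 * t - 2) - c) < (2 * t - 1) * q.
  by rewrite ltr_pM2l //; lra.
have : 0 <= c * ((2 * t - 1) * (4 * t - 5) - (2 * t - 2) * c).
  rewrite mulr_ge0 ?(ltW c0) // subr_ge0.
  have : (2 * t - 2) * c <= (2 * t - 2) * 1 by rewrite ler_wpM2l //; lra.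
  have : 0 <= (t - 2) * t by rewrite mulr_ge0; lra.
  by lra.
by lra.
Qed.

(* Here [b] is the number of triples in a set of [2 t] vertices, one of which is
   missing, and [p] is the contribution of the triples leaving that set. *)
Lemma missing_triple_value_le (R : realFieldType) (t c b p q : R) :
  2 <= t -> 0 < c -> t ^+ 3 * c = 1 / 8 -> t * c <= 1 / 32 -> c <= 1 / 64 ->
  6 * b = 2 * t * (2 * t - 1) * (2 * t - 2) -> p <= 4 * (t ^+ 2 * c) ->
  q <= (1 + c) ^+ 3 * (b - 1) + p ->
  3 * q <= t * ((2 * t - 1) * (2 * t - 2) - c).
Proof.
move=> t2 c0 t3c tc c_le bE p_le q_le.
have b_ge1 : 1 <= b.
  have : 0 <= (t - 2) * t ^+ 2 by rewrite mulr_ge0 ?sqr_ge0 //; lra.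
  have : 0 <= (t - 2) * t by rewrite mulr_ge0; lra.
  by lra.
have cube_le : (1 + c) ^+ 3 * (b - 1) <= (1 + 4 * c) * (b - 1).
  rewrite ler_wpM2r ?subr_ge0 //.
  have c2_le : c ^+ 2 <= c / 64 by rewrite expr2 ler_pM2l //; lra.
  have : c ^+ 3 <= c ^+ 2 by rewrite exprSr ler_piMr ?sqr_ge0 //; lra.
  by lra.
have bcE : b * c = (4 * (t ^+ 3 * c) - 6 * (t ^+ 2 * c) + 2 * (t * c)) / 3.
  by rewrite (_ : b = 2 * t * (2 * t - 1) * (2 * t - 2) / 6); [field|lra].
have t2c_ge0 : 0 <= t ^+ 2 * c by rewrite mulr_ge0 ?sqr_ge0 ?ltW.
by lra.
Qed.

Section StarFree.

Variables (R : realType) (G : hypergraph) (t : nat).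
Hypotheses (t_ge2 : (2 <= t)%N) (G3 : uniform 3 G).
Hypothesis star_free : ~ subgraph_of (linear_star 3 t) G.

Lemma star_free_link_poly_le (z : vert G -> R) (i : vert G) :
  (forall u, 0 <= z u <= z i) -> \sum_u z u = 2 * t%:R ->
  2 * link_poly i z <= (2 * t%:R - 1) * (2 * t%:R - 2) - 1 \/
  exists B : {set vert G}, [/\ i \notin B, (#|B| <= 2 * t - 1)%N &
    (2 * t%:R - 1) * (2 * link_poly i z) <=
      (2 * t%:R - 2) * (\sum_(u in B) z u) ^+ 2].
Proof.
move=> z0i z_sum; pose y u := if u == i then 0 else z u.
have y0i u : 0 <= y u <= z i.
  by rewrite /y; case: eqP => _ //; rewrite lexx; case/andP: (z0i i).
have y_sum : \sum_u y u = 2 * t%:R - z i.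
  rewrite -z_sum [X in X - _](bigD1 i) //= addrAC subrr.
  rewrite (bigD1 i) //= /y eqxx; congr (_ + _).
  by apply: eq_bigr => u /negPf->.
have yE : quad_form (link i) y = 2 * link_poly i z.
  rewrite -quad_form_link //; apply: eq_bigr => u _; apply: eq_bigr => v _.
  case: (boolP (link i u v)) => [/(link_neq G3)/and3P[iu iv _]|_]; last first.
    by rewrite !mul0r.
  by rewrite /y eq_sym (negPf iu) eq_sym (negPf iv).
have z0 : 0 <= z i by case/andP: (z0i i).
have := quad_form_matching_free_le t_ge2 z0 y0i y_sum (link_sym i) (link_irr i G3).
rewrite yE => -[|link_le|[B cardB link_le]]; first by move/(link_matching_star G3).
  by left.
right; exists (B :\ i); split; first by rewrite !inE eqxx.
  by rewrite (leq_trans _ cardB) // subset_leq_card ?subD1set.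
rewrite (_ : \sum_(u in _) _ = \sum_(u in B) y u) //.
rewrite [LHS]big_mkcond [RHS]big_mkcond; apply: eq_bigr => u _.
by rewrite !inE /y; case: eqP; case: ifP.
Qed.

Lemma star_free_optimum : 0 < lagrangian R G ->
  exists (z : vert G -> R) (i : vert G) (B : {set vert G}),
    [/\ forall u, 0 <= z u <= z i, \sum_u z u = 2 * t%:R,
        lagrange_poly z = (2 * t%:R) ^+ 3 * lagrangian R G,
        i \notin B /\ (#|B| <= 2 * t - 1)%N &
        24 * t%:R ^+ 2 * lagrangian R G <= (2 * t%:R - 1) * (2 * t%:R - 2) - 1 \/
        (2 * t%:R - 1) * (24 * t%:R ^+ 2 * lagrangian R G) <=
          (2 * t%:R - 2) * (\sum_(u in B) z u) ^+ 2].
Proof.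
move=> L_gt0; have t2 : 2 <= t%:R :> R by rewrite ler_nat.
have n0 : 0 < 2 * t%:R :> R by lra.
have [z [i [z0i z_sum zE link_ge]]] := exists_scaled_optimum G3 n0 L_gt0.
have {}link_ge : 24 * t%:R ^+ 2 * lagrangian R G <= 2 * link_poly i z.
  by rewrite /= in link_ge; lra.
have [/(le_trans link_ge) L_le|[B [iB cardB B_ge]]] :=
  star_free_link_poly_le z0i z_sum.
  by exists z, i, set0; split; rewrite ?inE ?cards0 //; left.
exists z, i, B; split=> //; right; apply: le_trans B_ge.
by rewrite ler_wpM2l //; lra.
Qed.

Lemma lagrangian_star_free_le :
  24 * t%:R ^+ 2 * lagrangian R G <= (2 * t%:R - 1) * (2 * t%:R - 2).
Proof.
have t2 : 2 <= t%:R :> R by rewrite ler_nat.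
have [L_le0|L_gt0] := leP (lagrangian R G) 0.
  apply: (@le_trans _ _ 0); last by rewrite mulr_ge0; lra.
  by rewrite mulr_ge0_le0 // mulr_ge0 // sqr_ge0.
have [z [i [B [z0i z_sum _ [iB cardB] []]]]] := star_free_optimum L_gt0.
  by lra.
have [w0] := block_sum_bounds z0i iB cardB; rewrite z_sum natrB ?natrM; last by lia.
move: (\sum_(u in B) z u) w0 (24 * _ * _) => w w0 q w_le1 w_le2 q_le.
have n0 : 0 < 2 * t%:R - 1 :> R by lra.
rewrite -(ler_pM2l n0); apply: le_trans q_le _.
have w_le : w <= 2 * t%:R - 1.
  have m0 : 0 < 2 * t%:R :> R by lra.
  have sum_le := ler_wpM2l (ltW n0) w_le1.
  by rewrite -(ler_pM2l m0); lra.
have : w ^+ 2 <= (2 * t%:R - 1) ^+ 2 by rewrite ler_sqr ?nnegrE //; lra.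
have m0 : 0 <= 2 * t%:R - 2 :> R by lra.
by move=> /(ler_wpM2l m0); lra.
Qed.

Definition near_uniform (z : vert G -> R) (W : {set vert G}) : Prop :=
  [/\ forall u, 0 <= z u <= 1 + stability_gap R t, \sum_u z u = 2 * t%:R,
      #|W| = (2 * t)%N & \sum_(u | u \notin W) z u <= 2 * stability_gap R t].

Lemma exists_near_uniform :
  (2 * t%:R - 1) * (2 * t%:R - 2) - stability_gap R t <
    24 * t%:R ^+ 2 * lagrangian R G ->
  exists (z : vert G -> R) (W : {set vert G}),
    near_uniform z W /\ lagrange_poly z = (2 * t%:R) ^+ 3 * lagrangian R G.
Proof.
have t2 : 2 <= t%:R :> R by rewrite ler_nat.
have c0 := stability_gap_gt0 R (ltnW t_ge2).
have [_ tc_le c_le] := stability_gap_mul R t_ge2.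
rewrite /near_uniform; move: (stability_gap R t) c0 tc_le c_le.
move=> c c0 tc_le c_le L_big.
have V1 : 1 <= (2 * t%:R - 1) * (2 * t%:R - 2) :> R.
  by rewrite mulr_ege1; lra.
have L_gt0 : 0 < lagrangian R G.
  have t2_gt0 : 0 < 24 * t%:R ^+ 2 :> R by rewrite mulr_gt0 ?exprn_gt0 //; lra.
  by rewrite -(pmulr_rgt0 _ t2_gt0); lra.
have [z [i [B [z0i z_sum zE [iB cardB] [|L_le]]]]] := star_free_optimum L_gt0.
  by lra.
have [w0] := block_sum_bounds z0i iB cardB.
rewrite z_sum natrB ?natrM => [w_le1 w_le2|]; last by clear - t_ge2; lia.
have w_gt : 2 * t%:R - 1 - c < \sum_(u in B) z u.
  by apply: near_extremal_sum_gt L_big L_le => //; rewrite c0; lra.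
have z0 u : 0 <= z u by case/andP: (z0i u).
have zi u : z u <= z i by case/andP: (z0i u).
have zi_le : z i <= 1 + c by lra.
have zi_ge : 1 - c <= z i.
  have n0 : 0 < 2 * t%:R - 1 :> R by lra.
  have c_le_mul : c <= (2 * t%:R - 1) * c by rewrite ler_peMl ?ltW //; lra.
  by rewrite -(ler_pM2l n0); lra.
exists z, (i |: B); split=> //; split=> //.
- by move=> u; rewrite z0 (le_trans (zi u)).
- rewrite cardsU1 iB; suff : (2 * t - 2 < #|B|)%N by clear - cardB; lia.
  rewrite ltnNge; apply/negP => /(sum_le_card (z0 i) zi).
  rewrite natrB ?natrM; last by clear - t_ge2; lia.
  have n0 : 0 <= 2 * t%:R - 2 :> R by lra.
  by have := ler_wpM2l n0 zi_le; lra.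
- by have := z_sum; rewrite (bigID (mem (i |: B))) /= big_setU1 //= => sumE; lra.
Qed.

Lemma near_uniform_not_clique_le (z : vert G -> R) (W : {set vert G}) :
  near_uniform z W -> ~ clique 3 W ->
  3 * lagrange_poly z <=
    t%:R * ((2 * t%:R - 1) * (2 * t%:R - 2) - stability_gap R t).
Proof.
have t2 : 2 <= t%:R :> R by rewrite ler_nat.
have c0 := stability_gap_gt0 R (ltnW t_ge2).
have [t3c tc c_le] := stability_gap_mul R t_ge2.
rewrite /near_uniform; move: (stability_gap R t) c0 t3c tc c_le.
move=> c c0 t3c tc c_le [z_le z_sum cardW out_le].
move=> /(lagrange_poly_not_clique G3 _ z_le)-/(_ _); rewrite cardW => poly_le.
have z0 u : 0 <= z u by case/andP: (z_le u).
have : \sum_(u | u \notin W) z u * link_poly u z <= 4 * (t%:R ^+ 2 * c).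
  apply: (@le_trans _ _ (\sum_(u | u \notin W) z u * (2 * t%:R ^+ 2))).
    apply: ler_sum => u _; rewrite ler_wpM2l //.
    by apply: le_trans (link_poly_le_sqr_sum u G3 z0) _; rewrite z_sum; lra.
  by rewrite -mulr_suml; have := ler_wpM2r (sqr_ge0 (t%:R : R)) out_le; lra.
have binE := natr_bin3 R (2 * t); rewrite natrM in binE.
move=> out_poly_le; apply: missing_triple_value_le binE out_poly_le _ => //.
by apply: poly_le; lra.
Qed.

Lemma lagrangian_star_free_gap :
  covers_pairs G -> ~ isomorphic G (complete 3 (2 * t)) ->
  24 * t%:R ^+ 2 * lagrangian R G <=
    (2 * t%:R - 1) * (2 * t%:R - 2) - stability_gap R t.
Proof.
move=> cov not_complete; rewrite leNgt; apply/negP => L_big.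
have [z [W [zW zE]]] := exists_near_uniform L_big.
have [_ _ cardW _] := zW.
have [W_clique|/(near_uniform_not_clique_le zW)] := pselect (clique 3 W).
  have W_all : W = setT.
    by apply: (@clique_spanning G 3 t) => //; [lia|rewrite cardW mulnC].
  apply: not_complete; apply: isomorphic_complete => //; first by rewrite -W_all.
  by rewrite -cardsT -W_all.
have t0 : 0 < t%:R :> R by rewrite ltr0n ltnW.
rewrite -(ltr_pM2l t0) in L_big; rewrite zE; lra.
Qed.

End StarFree.

Lemma lagrangian_complete (R : realType) (t : nat) : (2 <= t)%N ->
  24 * t%:R ^+ 2 * lagrangian R (complete 3 (2 * t)) =
    (2 * t%:R - 1) * (2 * t%:R - 2).
Proof.
move=> t_ge2; have t0 : 0 < t%:R :> R by rewrite ltr0n ltnW.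
apply/eqP; rewrite eq_le lagrangian_star_free_le //=.
- have n0 : (0 < 2 * t)%N by rewrite muln_gt0 (ltnW t_ge2).
  have c0 : 0 < 24 * t%:R ^+ 2 :> R by rewrite mulr_gt0 // exprn_gt0.
  have := lagrangian_complete_ge R 3 n0; rewrite -(ler_pM2l c0); apply: le_trans.
  have binE := natr_bin3 R (2 * t); rewrite natrM in binE.
  have -> : 'C(2 * t, 3)%:R = 2 * t%:R * (2 * t%:R - 1) * (2 * t%:R - 2) / 6 :> R.
    by lra.
  rewrite natrM le_eqVlt; apply/orP; left; apply/eqP; field.
  by rewrite gt_eqF //; lra.
- exact: complete_uniform.
- by apply: linear_star_free_card; rewrite card_ord mulnC.
Qed.

Theorem theorem4p5 (R : realType) (t : nat) (ht : (2 <= t)%N) :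
  [/\ forall G : hypergraph,
        uniform 3 G -> ~ subgraph_of (linear_star 3 t) G ->
        lagrangian R G <= lagrangian R (complete 3 (2 * t)),
      exists2 c2 : R, 0 < c2 &
        forall G : hypergraph,
          uniform 3 G -> ~ subgraph_of (linear_star 3 t) G ->
          covers_pairs G -> ~ isomorphic G (complete 3 (2 * t)) ->
          lagrangian R G <= lagrangian R (complete 3 (2 * t)) - c2
    & lagrangian R (complete 3 (2 * t)) =
        (2 * t%:R - 1) * (t%:R - 1) / (12 * t%:R ^+ 2)].
Proof.
have t0 : 0 < t%:R :> R by rewrite ltr0n ltnW.
have c0 : 0 < 24 * t%:R ^+ 2 :> R by rewrite mulr_gt0 // exprn_gt0.
have completeE := lagrangian_complete R ht.
split.
- move=> G G3 star_free; rewrite -(ler_pM2l c0) completeE.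
  exact: lagrangian_star_free_le.
- exists (stability_gap R t / (24 * t%:R ^+ 2)).
    by rewrite divr_gt0 // stability_gap_gt0 // ltnW.
  move=> G G3 star_free cov not_complete; rewrite -(ler_pM2l c0) mulrBr completeE.
  rewrite [X in _ - X]mulrCA divff ?gt_eqF // mulr1.
  exact: lagrangian_star_free_gap.
- by apply: (mulfI (lt0r_neq0 c0)); rewrite completeE; field; rewrite gt_eqF.
Qed.
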